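(* Let $m>n\ge1$ be relatively prime integers, $\kappa>0$, and $$\Delta^U_{n,m}(\kappa)=\{(x_1,x_2)\in\mathbb R^2: x_1\ge0,\ x_2\ge0,\ -nx_1+mx_2+\kappa>0\}.$$ Let $x=(x_1,x_2)\in\mathrm{Int}\,\Delta^U_{n,m}(\kappa)$. If $x$ is to the left of the line through $(\kappa/n,0)$ with slope $1/(\lceil m/n\rceil-1)$, that is, if $$x_1<(\lceil m/n\rceil-1)\,x_2+\kappa/n,$$ then $x$ can be displaced by a parallel extended probe with flag in $\Delta^U_{n,m}(\kappa)$.
   Context: $\Delta=\Delta^U_{n,m}(\kappa)$ is the image of the open set $U_{n,m}(\kappa)=\{z\in\mathbb C^2:-n|z_1|^2+m|z_2|^2+\kappa>0\}$, with symplectic form $\omega_0=\frac1\pi\sum dx_k\wedge dy_k$, under the moment map $\Phi_0(z)=(|z_1|^2,|z_2|^2)$. Its facets are those in $\{x_1=0\}$ and $\{x_2=0\}$; the slanted boundary is not part of $\Delta$. Affine distance. If $x,y$ lie on a line with primitive integral direction $v$ and $x-y=tv$, then $d_{\mathrm{aff}}(x,y)=|t|$. For a facet $F\subset\{\langle\eta_F,x\rangle+\kappa_F=0\}$ with primitive interior conormal $\eta_F$, $d_{\mathrm{aff}}(x,F)=|\langle\eta_F,x\rangle+\kappa_F|$. A probe $P$ in $\Delta$ is a directed line segment contained in $\Delta$ starting at a point $b_P$ in the interior of a facet $F_P$, with primitive direction $v_P\in\mathbb Z^2$ satisfying $\langle\eta_{F_P},v_P\rangle=1$, and ending at $b_P+\ell(P)v_P$;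 $\ell(P)$ is its length. Let $P,Q$ be probes in $\Delta$ such that $P$ ends at a point $x_{PQ}$ on $Q$ and $v_P$ is parallel to $F_Q$. A parallel extended probe with flag formed by deflecting $P$ with $Q$ is a subset $\mathcal{FP}=P\cup Q\cup\mathcal F\subset\Delta$, where the flag $\mathcal F$ is the convex hull of points $x_{\mathcal F},x'_{\mathcal F}\in Q$ and $e_{\mathcal F}=x_{\mathcal F}+\ell(\mathcal F)v_P$, $e'_{\mathcal F}=x'_{\mathcal F}+\ell(\mathcal F)v_P$, with $\ell(\mathcal F)\ge0$. Its length is $\ell(\mathcal{FP})=\ell(P)+\ell(\mathcal F)$. A point $u\in\mathrm{Int}\,\Delta$ can be displaced by $\mathcal{FP}$ if $u$ is in the relative interior of $P$, $d_{\mathrm{aff}}(u,F_P)<\tfrac12\ell(\mathcal{FP})$ and $d_{\mathrm{aff}}(x_{PQ},F_Q)<d_{\mathrm{aff}}(x_{\mathcal F},x'_{\mathcal F})$; the Lagrangian fiber $\Phi_0^{-1}(u)$ is then displaceable in $U_{n,m}(\kappa)$ by a compactly supported Hamiltonian diffeomorphism. *)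

(* Defs.v *)
From HB Require Import structures.
From mathcomp Require Import all_boot all_order all_algebra.
From mathcomp Require Import all_classical all_reals all_analysis.
From mathcomp Require Import ring lra.

Set Implicit Arguments.
Unset Strict Implicit.
Unset Printing Implicit Defensive.

Import Order.TTheory GRing.Theory Num.Theory.
Import numFieldNormedType.Exports.

Local Open Scope classical_set_scope.
Local Open Scope ring_scope.

Definition DeltaU (R : realType) (n m : nat) (kappa : R) : set (R * R) :=
  [set x | [/\ 0 <= x.1, 0 <= x.2 & 0 < - n%:R * x.1 + m%:R * x.2 + kappa]].

Definition convex_hull (R : realType) (A : set (R * R)) : set (R * R) :=
  smallest (@convex_set R (R * R)%type) A.

Definition affine_set (R : realType) (A : set (R * R)) : Prop :=
  forall p q (t : R), A p -> A q -> A (p + t *: (q - p)).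

Definition affine_hull (R : realType) (A : set (R * R)) : set (R * R) :=
  smallest (@affine_set R) A.

Definition relint (R : realType) (A : set (R * R)) : set (R * R) :=
  [set p | A p /\ \forall q \near p, affine_hull A q -> A q].

Definition primitive (v : int * int) : bool := coprimez v.1 v.2.

Definition intvec (R : realType) (v : int * int) : R * R :=
  (v.1%:~R, v.2%:~R).

Definition pairing (R : realType) (eta : int * int) (x : R * R) : R :=
  eta.1%:~R * x.1 + eta.2%:~R * x.2.

(* The affine distance exists only for points on a common rational line, so
   it is a (functional) relation: [affine_dist x y d] reads
   "d_aff(x, y) is defined and equal to d". *)
Definition affine_dist (R : realType) (x y : R * R) (d : R) : Prop :=
  exists (v : int * int) (t : R),
    [/\ primitive v, x - y = t *: intvec R v & d = `|t|].

(* The line {<eta, x> + c = 0} spanned by a facet, cooriented by eta. *)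
Record facet (R : realType) :=
  Facet { conormal : int * int; offset : R }.

Definition facet_fun (R : realType) (F : facet R) (x : R * R) : R :=
  pairing (conormal F) x + offset F.

Definition facet_set (R : realType) (D : set (R * R)) (F : facet R) :
    set (R * R) :=
  D `&` [set x | facet_fun F x = 0].

(* The second clause makes the conormal interior; two distinct
   points make the face one-dimensional. A boundary edge that is not part of D
   (such as the slanted edge of DeltaU) yields no facet. *)
Definition is_facet (R : realType) (D : set (R * R)) (F : facet R) : Prop :=
  [/\ primitive (conormal F),
      (forall x, D x -> 0 <= facet_fun F x) &
      exists p q, [/\ facet_set D F p, facet_set D F q & p <> q]].

Lemma DeltaU_facets (R : realType) (n m : nat) (kappa : R) (F : facet R) :
  (0 < n)%N -> 0 < kappa ->
  is_facet (DeltaU n m kappa) F <->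
  F = Facet (1, 0) 0 \/ F = Facet (0, 1) 0.
Proof.
move=> n0 k0; have n0R : 0 < n%:R :> R by rewrite ltr0n.
have kn : 0 < kappa / n%:R by rewrite divr_gt0.
have knE : n%:R * (kappa / n%:R) = kappa.
  by rewrite mulrC -mulrA mulVf ?mulr1// gt_eqF.
have D0 y : 0 <= y -> DeltaU n m kappa (0, y).
  move=> y0; split => //=; rewrite mulr0 add0r.
  by rewrite ltr_wpDl// mulr_ge0.
have D1 : DeltaU n m kappa (kappa / n%:R / 2, 0).
  by split => //=; [lra|nra].
split; last first.
  case=> ->; split => //=.
  - by move=> [a b] [/= a0 _ _]; rewrite /facet_fun /pairing /=; lra.
  - exists (0, 0), (0, 1); split; last by case=> /eqP; rewrite eq_sym oner_eq0.
      by split; [exact: D0|rewrite /= /facet_fun /pairing /=; lra].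
    by split; [exact: D0|rewrite /= /facet_fun /pairing /=; lra].
  - by move=> [a b] [/= _ b0 _]; rewrite /facet_fun /pairing /=; lra.
  - exists (0, 0), (kappa / n%:R / 2, 0); split; last by case=> h; lra.
      by split; [exact: D0|rewrite /= /facet_fun /pairing /=; lra].
    by split; [exact: D1|rewrite /= /facet_fun /pairing /=; lra].
case: F => -[a b] c [/= pr pos [[p1 p2] [[q1 q2] [[Dp Fp] [Dq Fq] pq]]]].
move: pos Fp Fq; rewrite /facet_fun /pairing /= => pos Fp Fq.
move: pr; rewrite /primitive /coprimez /=.
set A : R := a%:~R in pos Fp Fq; set B : R := b%:~R in pos Fp Fq.
have C0 : 0 <= c by have := pos (0, 0) (D0 0 (lexx _)); rewrite /=; lra.
have A1 : 0 <= A * (kappa / n%:R / 2) + c by have := pos _ D1; rewrite /=; lra.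
have B0 : 0 <= B.
  rewrite leNgt; apply/negP => Bn.
  have y0 : 0 <= (c + 1) / - B by rewrite divr_ge0//; lra.
  have := pos (0, (c + 1) / - B) (D0 _ y0).
  have BE : B * ((c + 1) / - B) = - (c + 1) by field; lra.
  by rewrite /= BE; lra.
case: Dp Dq => /= p10 p20 pk [/= q10 q20 qk] pr.
pose x1 := (p1 + q1) / 2; pose x2 := (p2 + q2) / 2.
have Fx : A * x1 + B * x2 + c = 0 by rewrite /x1 /x2; lra.
have x10 : 0 <= x1 by rewrite /x1; lra.
have x20 : 0 <= x2 by rewrite /x2; lra.
have xk : 0 < - n%:R * x1 + m%:R * x2 + kappa by rewrite /x1 /x2; lra.
have Dx u : 0 <= u -> 0 < - n%:R * u + m%:R * x2 + kappa -> 0 <= A * (u - x1).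
  by move=> u0 uk; have := pos (u, x2); rewrite /= => /(_ (And3 u0 x20 uk)); lra.
have [x1E|x1N] := eqVneq x1 0.
  have [p1E q1E] : p1 = 0 /\ q1 = 0 by move: x1E; rewrite /x1; split; lra.
  have BE : B = 0.
    apply/eqP/negPn/negP => BN; apply: pq; congr (_, _); first by rewrite p1E.
    by apply: (mulfI BN); rewrite p1E q1E in Fp Fq; lra.
  have cE : c = 0 by rewrite x1E BE in Fx; lra.
  have bE : b = 0 by apply/eqP; rewrite -(intr_eq0 R); apply/eqP.
  have a0 : 0 <= a.
    rewrite -(ler0z R) -/A; move: A1; rewrite cE addr0 pmulr_lge0 //; lra.
  left; rewrite cE bE; move: pr; rewrite bE gcdz0.
  by rewrite abszE ger0_norm// => /eqP ->.
have x1p : 0 < x1 by rewrite lt_neqAle eq_sym x1N.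
have AE : A = 0.
  apply/le_anti/andP; split.
    have h := Dx 0 (lexx _) ltac:(nra).
    by rewrite leNgt; apply/negP => Ap; nra.
  pose s := - n%:R * x1 + m%:R * x2 + kappa.
  have s0 : 0 < s / n%:R by rewrite divr_gt0.
  have sE : n%:R * (s / n%:R) = s.
    by rewrite mulrC -mulrA mulVf ?mulr1// gt_eqF.
  have h := Dx (x1 + s / n%:R / 2) ltac:(lra) ltac:(rewrite /s in sE s0 *; nra).
  by rewrite leNgt; apply/negP => An; nra.
have aE : a = 0 by apply/eqP; rewrite -(intr_eq0 R); apply/eqP.
have cE : c = 0 by rewrite AE in Fx; nra.
have b0 : 0 <= b by rewrite -(ler0z R).
right; rewrite cE aE; move: pr; rewrite aE gcd0z.
by rewrite abszE ger0_norm// => /eqP ->.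
Qed.

Definition facet_dist (R : realType) (x : R * R) (F : facet R) : R :=
  `|facet_fun F x|.

Record probe (R : realType) := Probe {
  base_facet : facet R;
  base : R * R;
  dir : int * int;
  len : R
}.

Definition probe_end (R : realType) (P : probe R) : R * R :=
  base P + len P *: intvec R (dir P).

Definition probe_set (R : realType) (P : probe R) : set (R * R) :=
  [set base P + t *: intvec R (dir P) | t in `[0, len P]].

Definition is_probe (R : realType) (D : set (R * R)) (P : probe R) : Prop :=
  [/\ is_facet D (base_facet P),
      relint (facet_set D (base_facet P)) (base P),
      primitive (dir P),
      pairing (conormal (base_facet P)) (intvec R (dir P)) = 1 &
      0 < len P /\ probe_set P `<=` D].

Record flag_probe (R : realType) := FlagProbe {
  main : probe R;
  deflector : probe R;
  flag_pt : R * R;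
  flag_pt' : R * R;
  flag_len : R
}.

Definition flag (R : realType) (FP : flag_probe R) : set (R * R) :=
  let w := flag_len FP *: intvec R (dir (main FP)) in
  convex_hull [set z | z \in [:: flag_pt FP; flag_pt' FP;
                                 flag_pt FP + w; flag_pt' FP + w]].

Definition flag_probe_set (R : realType) (FP : flag_probe R) : set (R * R) :=
  probe_set (main FP) `|` probe_set (deflector FP) `|` flag FP.

Definition flag_probe_len (R : realType) (FP : flag_probe R) : R :=
  len (main FP) + flag_len FP.

Definition is_parallel_flag_probe (R : realType) (D : set (R * R))
    (FP : flag_probe R) : Prop :=
  let P := main FP in
  let Q := deflector FP in
  [/\ is_probe D P /\ is_probe D Q,
      probe_set Q (probe_end P),
      pairing (conormal (base_facet Q)) (intvec R (dir P)) = 0,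
      [/\ probe_set Q (flag_pt FP), probe_set Q (flag_pt' FP) &
          0 <= flag_len FP] &
      flag_probe_set FP `<=` D].

Definition displaced_by (R : realType) (D : set (R * R)) (u : R * R)
    (FP : flag_probe R) : Prop :=
  [/\ interior D u,
      relint (probe_set (main FP)) u,
      facet_dist u (base_facet (main FP)) < 2^-1 * flag_probe_len FP &
      exists2 d : R, affine_dist (flag_pt FP) (flag_pt' FP) d &
        facet_dist (probe_end (main FP)) (base_facet (deflector FP)) < d].

(* Main.v *)
Require Import Defs.
From mathcomp Require Import all_boot all_order all_algebra.
From mathcomp Require Import all_classical all_reals all_analysis.
From mathcomp Require Import ring lra.
Import Order.TTheory GRing.Theory Num.Theory.
Import numFieldNormedType.Exports.
Local Open Scope classical_set_scope.
Local Open Scope ring_scope.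

(** Write [k] for the ceiling of [m / n] minus 1, so that [0 <= k < m / n]. A
    ray of direction [(k, 1)] from a point [(b, 0)] of the lower facet never
    meets the slanted edge; its horizontal distance to that edge grows without
    bound. The assumption on [x] says that [x] lies to the left of such a ray
    issued from [(kappa / n, 0)], hence also to the left of the ray from
    [(b, 0)] for some [b < kappa / n].

    Deflect the horizontal probe through [x], which starts on the left facet,
    with the probe along this ray. The flag is attached high up on the ray,
    where there is room for any prescribed length and extent; a flag that is
    long and wide enough satisfies both inequalities for displaceability
    ([displaced_left_of_slanted_probe]). The two segments are probes by
    [horizontal_probe] and [slanted_probe]; the flag, a convex hull, stays in
    the convex polygon as soon as its corners do ([flag_sub_DeltaU]). *)

Lemma near_fst_gt (R : realType) (p : R * R) (a : R) :
  a < p.1 -> \forall q \near p, a < q.1.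
Proof.
move=> ap; have h : q.1 @[q --> p] --> p.1 by exact: cvg_fst.
exact: cvgr_gt h _ ap.
Qed.

Lemma near_fst_lt (R : realType) (p : R * R) (a : R) :
  p.1 < a -> \forall q \near p, q.1 < a.
Proof.
move=> pa; have h : q.1 @[q --> p] --> p.1 by exact: cvg_fst.
exact: cvgr_lt h _ pa.
Qed.

Lemma near_snd_gt (R : realType) (p : R * R) (a : R) :
  a < p.2 -> \forall q \near p, a < q.2.
Proof.
move=> ap; have h : q.2 @[q --> p] --> p.2 by exact: cvg_snd.
exact: cvgr_gt h _ ap.
Qed.

Lemma affine_level_set (R : realType) (eta : int * int) (c : R) :
  affine_set [set x : R * R | pairing eta x = c].
Proof.
move=> p q t /=; rewrite /pairing /= => hp hq.
transitivity (c + t * (c - c)); last by rewrite subrr mulr0 addr0.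
rewrite -{2}hq -{1 2}hp; rewrite /GRing.scale /=; ring.
Qed.

(** A level set is already affine, so it contains the affine hull of [A]; a
    neighbourhood of [p] only has to be inspected inside that line. This is
    how relative interiors of facets and of probes are computed below. *)
Lemma relint_level_set (R : realType) (A : set (R * R)) (eta : int * int)
    (c : R) (p : R * R) :
  A `<=` [set q | pairing eta q = c] -> A p ->
  (\forall q \near p, pairing eta q = c -> A q) -> relint A p.
Proof.
move=> Ac Ap nA; split=> //; apply: filterS nA => q hA hq; apply: hA.
exact: (smallest_sub (affine_level_set R eta c) Ac hq).
Qed.

(** A small step to the left of, or below, an interior point stays in the
    moment polygon, whose points have nonnegative coordinates. *)
Lemma interior_DeltaU_gt0 (R : realType) (n m : nat) (kappa : R) (x : R * R) :
  interior (DeltaU n m kappa) x -> 0 < x.1 /\ 0 < x.2.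
Proof.
move=> /nbhs_ballP [e /= e0 sub].
have e2 : 0 < e / 2 by rewrite divr_gt0.
have ball2 (y : R) : ball y e (y - e / 2).
  by rewrite -ball_normE /ball_ /= opprB addrC subrK gtr0_norm//; lra.
split.
- have [|/= h _ _] := sub (x.1 - e / 2, x.2); last by lra.
  by split => /=; [exact: ball2|exact: ballxx].
- have [|/= _ h _] := sub (x.1, x.2 - e / 2); last by lra.
  by split => /=; [exact: ballxx|exact: ball2].
Qed.

Lemma convex_DeltaU (R : realType) (n m : nat) (kappa : R) :
  @convex_set R (R * R)%type (DeltaU n m kappa).
Proof.
apply/convex_setW => -[p1 p2] [q1 q2]; rewrite !inE /=.
move=> [/= p10 p20 p30] [/= q10 q20 q30] l l0 l1.
set t : R := l%:num in l0 l1.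
apply: mem_set.
change (DeltaU n m kappa
   (t * p1 + (1 - t) * q1, t * p2 + (1 - t) * q2)).
have t1 : 0 < 1 - t by lra.
have tk := mulr_gt0 l0 p30; have sk := mulr_gt0 t1 q30.
split => /=; [by rewrite addr_ge0// mulr_ge0// ltW..|].
suff -> : - n%:R * (t * p1 + (1 - t) * q1) + m%:R * (t * p2 + (1 - t) * q2) +
    kappa = t * (- n%:R * p1 + m%:R * p2 + kappa) +
            (1 - t) * (- n%:R * q1 + m%:R * q2 + kappa) by exact: addr_gt0.
by ring.
Qed.

(** The slanted edge bounds the polygon on the right only: along a horizontal
    line, its inequality at [a'] gives it at every [a <= a']. *)
Lemma DeltaU_leftward (R : realType) (n m : nat) (kappa a a' y : R) :
  0 <= a -> a <= a' -> 0 <= y -> 0 < - n%:R * a' + m%:R * y + kappa ->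
  DeltaU n m kappa (a, y).
Proof.
move=> a0 aa' y0 h; split=> //=; apply: lt_le_trans h _.
by rewrite !lerD2r !mulNr lerN2 ler_wpM2l.
Qed.

Lemma horizontal_probe (R : realType) (n m : nat) (kappa y L : R) :
  (0 < n)%N -> 0 < kappa -> 0 < y -> 0 < L ->
  0 < - n%:R * L + m%:R * y + kappa ->
  is_probe (DeltaU n m kappa) (Probe (Facet (1, 0) 0) (0, y) (1, 0) L).
Proof.
move=> n0 k0 y0 L0 hL.
have D0 z : 0 <= z -> DeltaU n m kappa (0, z).
  by move=> z0; split=> //=; rewrite mulr0 add0r ltr_wpDl// mulr_ge0.
split=> //=.
- by apply/DeltaU_facets => //; left.
- apply: (@relint_level_set R _ (1, 0) 0).
  + by move=> q [_ /=]; rewrite /facet_fun /= addr0.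
  + by split; [apply: D0; rewrite ltW|rewrite /= /facet_fun /pairing /=; lra].
  + apply: filterS (near_snd_gt R (0, y) 0 y0) => -[q1 q2] /= q20.
    rewrite /pairing /= => q1E.
    have -> : q1 = 0 by lra.
    by split; [apply: D0; rewrite ltW|rewrite /= /facet_fun /pairing /=; lra].
- by rewrite /pairing /=; lra.
- split=> // _ [t /= /[!in_itv]/= /andP[t0 tL] <-].
  apply: (@DeltaU_leftward _ _ _ _ _ L) => //=; rewrite /GRing.scale /=;
    [by lra|by lra|by lra|].
  suff -> : y + t * 0%:~R = y by []. by ring.
Qed.

(** Since [k] is smaller than [m / n], a ray of direction [(k, 1)] moves away
    from the slanted edge as it rises; hence the probe may have any length. *)
Lemma slanted_probe (R : realType) (n m : nat) (kappa b L : R) (k : int) :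
  (0 < n)%N -> 0 < kappa -> 0 <= k%:~R :> R -> n%:R * k%:~R < m%:R :> R ->
  0 < b -> n%:R * b < kappa -> 0 < L ->
  is_probe (DeltaU n m kappa) (Probe (Facet (0, 1) 0) (b, 0) (k, 1) L).
Proof.
move=> n0 kappa0 k0 km b0 bk L0; have n0R : 0 < n%:R :> R by rewrite ltr0n.
split=> //=.
- by apply/DeltaU_facets => //; right.
- apply: (@relint_level_set R _ (0, 1) 0).
  + by move=> q [_ /=]; rewrite /facet_fun /= addr0.
  + by split; [split=> /=; lra|rewrite /= /facet_fun /pairing /=; lra].
  + have bk' : b < kappa / n%:R by rewrite ltr_pdivlMr// mulrC.
    have near1 := near_fst_gt R (b, 0) 0 b0.
    have near2 := near_fst_lt R (b, 0) _ bk'.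
    apply: filterS2 near1 near2 => -[q1 q2] /= q10.
    rewrite ltr_pdivlMr// mulrC /pairing /= => q1k q2E.
    have -> : q2 = 0 by lra.
    by split; [split=> /=; lra|rewrite /= /facet_fun /pairing /=; lra].
- by rewrite /primitive /coprimez gcdz1.
- by rewrite /pairing /=; lra.
- split=> // _ [t /= /[!in_itv]/= /andP[t0 tL] <-].
  have tK : 0 <= t * k%:~R by rewrite mulr_ge0.
  have tm : 0 <= t * (m%:R - n%:R * k%:~R) by rewrite mulr_ge0//; lra.
  by split=> /=; rewrite /GRing.scale /=; lra.
Qed.

Lemma flag_sub_DeltaU (R : realType) (n m : nat) (kappa : R)
    (FP : flag_probe R) :
  let w := flag_len FP *: intvec R (dir (main FP)) in
  DeltaU n m kappa (flag_pt FP) -> DeltaU n m kappa (flag_pt' FP) ->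
  DeltaU n m kappa (flag_pt FP + w) -> DeltaU n m kappa (flag_pt' FP + w) ->
  flag FP `<=` DeltaU n m kappa.
Proof.
move=> w D1 D2 D3 D4; apply: smallest_sub; first exact: convex_DeltaU.
by move=> z /=; rewrite !inE => /or4P[] /eqP ->.
Qed.

(** The horizontal probe through [x] is stopped by the slanted probe from
    [(b, 0)]. At height [t] the horizontal distance from the slanted probe to
    the slanted edge exceeds [t * (m - n * k) / n], so from some height [T] on
    a flag of length [2 * x.1] fits, whatever its extent along the slanted
    probe. That length alone makes [x.1] less than half the length of the
    extended probe, and the extent [x.2 + 1] exceeds the distance [x.2] from
    the deflection point to the lower facet. *)
Lemma displaced_left_of_slanted_probe (R : realType) (n m : nat)
    (kappa b : R) (k : int) (x : R * R) :
  (0 < n)%N -> 0 < kappa -> 0 <= k%:~R :> R -> n%:R * k%:~R < m%:R :> R ->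
  0 < b -> n%:R * b < kappa ->
  interior (DeltaU n m kappa) x -> x.1 < b + x.2 * k%:~R ->
  exists2 FP : flag_probe R,
    is_parallel_flag_probe (DeltaU n m kappa) FP &
    displaced_by (DeltaU n m kappa) x FP.
Proof.
move=> n0 kappa0 K0 km b0 bk hx xb; have n0R : 0 < n%:R :> R by rewrite ltr0n.
have [x10 x20] := interior_DeltaU_gt0 _ _ _ _ _ hx.
set K : R := k%:~R in K0 km xb *.
have s0 : 0 < m%:R - n%:R * K by lra.
(* at height [T] the room between slanted probe and edge is over [2 * x.1] *)
pose T := 2 * n%:R * x.1 / (m%:R - n%:R * K).
have TE : T * (m%:R - n%:R * K) = 2 * n%:R * x.1.
  by rewrite /T -mulrA mulVf ?mulr1// gt_eqF.
have T0 : 0 < T by rewrite divr_gt0// !mulr_gt0.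
pose T' := T + x.2 + 1; pose L := b + x.2 * K.
pose P := Probe (Facet (1, 0) 0) (0, x.2) (1, 0) L.
pose Q := Probe (Facet (0, 1) 0) (b, 0) (k, 1) T'.
have Qpt t : 0 <= t -> t <= T' -> probe_set Q (b + t * K, t).
  move=> t0 tT'; exists t; first by rewrite /= in_itv /= t0 tT'.
  by congr (_, _); rewrite /= /GRing.scale /= ?mulr1 ?add0r.
have flagD t l : T <= t -> 0 <= l -> l <= 2 * x.1 ->
    DeltaU n m kappa (b + t * K + l, t).
  move=> Tt l0 l1.
  have tK : 0 <= t * K by rewrite mulr_ge0//; lra.
  have room : 0 <= (t - T) * (m%:R - n%:R * K) by rewrite mulr_ge0//; lra.
  by apply: (@DeltaU_leftward _ _ _ _ _ (b + t * K + 2 * x.1)); lra.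
have xK : 0 <= x.2 * (m%:R - n%:R * K) by rewrite mulr_ge0// ltW.
have L0 : 0 < L by rewrite /L; lra.
have probeP : is_probe (DeltaU n m kappa) P.
  by apply: horizontal_probe => //; rewrite /L; lra.
have probeQ : is_probe (DeltaU n m kappa) Q.
  by apply: slanted_probe => //; rewrite /T'; lra.
exists (FlagProbe P Q (b + T * K, T) (b + T' * K, T') (2 * x.1)).
  split=> //=.
  - rewrite [probe_end P](_ : _ = (b + x.2 * K, x.2)).
      by apply: Qpt; rewrite /T'; lra.
    by congr (_, _); rewrite /= /GRing.scale /= /L ?mulr1 ?mulr0 ?add0r ?addr0.
  - by rewrite /pairing /=; lra.
  - by split; [apply: Qpt; rewrite /T'; lra..|lra].
  - have [_ _ _ _ [_ PD]] := probeP.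
    have [_ _ _ _ [_ QD]] := probeQ.
    move=> z [[/PD|/QD]//|].
    have shift t : (b + t * K, t) + (2 * x.1) *: intvec R (1, 0) =
        (b + t * K + 2 * x.1, t).
      by congr (_, _); rewrite /= /GRing.scale /= ?mulr1 ?mulr0 ?addr0.
    apply: flag_sub_DeltaU => /=; rewrite ?shift.
    + by rewrite -[b + _]addr0; apply: flagD; lra.
    + by rewrite -[b + _]addr0; apply: flagD; rewrite /T'; lra.
    + by apply: flagD; lra.
    + by apply: flagD; rewrite /T'; lra.
split=> //=.
- have Pset q : q.2 = x.2 -> 0 <= q.1 -> q.1 <= L -> probe_set P q.
    move=> q2 q10 q1L; exists q.1; first by rewrite /= in_itv /= q10 q1L.
    by rewrite [q in RHS]surjective_pairing q2; congr (_, _);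
      rewrite /= /GRing.scale /= ?mulr1 ?mulr0 ?add0r ?addr0.
  apply: (@relint_level_set R _ (0, 1) x.2).
  + by move=> _ [t _ <-] /=; rewrite /pairing /= /GRing.scale /=; ring.
  + by apply: Pset => //; rewrite /L; lra.
  + apply: filterS2 (near_fst_gt R x 0 x10) (near_fst_lt R x L xb) => q q0 qL.
    by rewrite /pairing /= => q2; apply: Pset; lra.
- rewrite /facet_dist /facet_fun /flag_probe_len /pairing /=.
  by rewrite mul1r mul0r !addr0 gtr0_norm//; lra.
- exists `|T - T'|.
    exists (k, 1), (T - T'); split=> //.
      by rewrite /primitive /coprimez gcdz1.
    by congr (_, _); rewrite /= /GRing.scale /=; ring.
  rewrite /facet_dist /facet_fun /pairing /= /GRing.scale /=.
  rewrite mul0r add0r mul1r mulr0 !addr0 gtr0_norm//.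
  by rewrite ltr0_norm /T'; lra.
Qed.

Theorem lemma3p2p2 (R : realType) (n m : nat) (kappa : R)
    (hn : (1 <= n)%N) (hmn : (n < m)%N) (hcop : coprime m n)
    (hkappa : 0 < kappa) (x : R * R) (hx : interior (DeltaU n m kappa) x)
    (hleft : x.1 < (Num.ceil (m%:R / n%:R : R) - 1)%:~R * x.2 + kappa / n%:R) :
  exists2 FP : flag_probe R,
    is_parallel_flag_probe (DeltaU n m kappa) FP &
    displaced_by (DeltaU n m kappa) x FP.
Proof.
have n0 : 0 < n%:R :> R by rewrite ltr0n.
have m0 : 0 < m%:R :> R by rewrite ltr0n (leq_trans _ hmn).
have kn : 0 < kappa / n%:R by rewrite divr_gt0.
have ceil_lt := ceilB1_lt (m%:R / n%:R : R).
set k := Num.ceil _ - 1 in hleft ceil_lt.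
have k0 : 0 <= k%:~R :> R.
  by rewrite ler0z subr_ge0 -gtz0_ge1 ceil_gt0 divr_gt0.
(* [b] must exceed [x.1 - k * x.2] to leave [x] on the left, and lie in the
   open lower edge; the maximum with 0 covers points with [x.1 < k * x.2] *)
pose b := (Num.max 0 (x.1 - k%:~R * x.2) + kappa / n%:R) / 2.
have maxlt : Num.max 0 (x.1 - k%:~R * x.2) < kappa / n%:R.
  by rewrite gt_max kn /=; lra.
have max0 : 0 <= Num.max 0 (x.1 - k%:~R * x.2) by rewrite le_max lexx.
have maxx : x.1 - k%:~R * x.2 <= Num.max 0 (x.1 - k%:~R * x.2).
  by rewrite le_max lexx orbT.
apply: (@displaced_left_of_slanted_probe R n m kappa b k x) => //.
- by rewrite mulrC -ltr_pdivlMr.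
- by rewrite /b; lra.
- by rewrite mulrC -ltr_pdivlMr// /b; lra.
- by rewrite /b; lra.
Qed.
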